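(* Let $\{x_k\}_{k=0}^{\infty}$ be a sequence generated by Algorithm 1 (described in the context), with $\psi(x_k,y_k)\ne0$ for all $k$ and with $\max\{\sigma_k\theta(x_k),-\alpha_k\}=\sigma_k\theta(x_k)$ for all $k$. If there exists $x^*\in\Omega$ such that $\mathcal{V}(x^* )\preceq\mathcal{V}(x_k)$ for all $k$, then $$u_0(x_k)<\frac{1}{\varpi\beta\sigma_{\min}^2k}\quad\text{for all } k\in\mathbb{N},\ k\ge1.$$
   Context: Setting. $m,n\ge 1$ are integers and $\Omega\subset\mathbb{R}^n$ is non-empty, compact and convex. For $i=1,\dots,m$: $f_i:\mathbb{R}^n\to\mathbb{R}$ is convex and continuously differentiable, and $\nabla f_i$ is $L_i$-Lipschitz continuous; $g_i:\mathbb{R}^n\to\mathbb{R}\cup\{+\infty\}$ is convex, proper, lower semicontinuous (not necessarily differentiable) and $L_{g_i}$-Lipschitz continuous on its domain $\mathrm{dom}(g_i)=\{x: g_i(x)<+\infty\}$. Put $\mathcal{D}=\bigcap_{i=1}^m\mathrm{dom}(g_i)$ and assume $\Omega\subset\mathcal{D}$. Put $\mathcal{F}=(f_1,\dots,f_m)$, $\mathcal{G}=(g_1,\dots,g_m)$, $\mathcal{V}=\mathcal{F}+\mathcal{G}=(\mathcal{V}_1,\dots,\mathcal{V}_m)$ with $\mathcal{V}_i=f_i+g_i$, $L=\max_i L_i$, $L_G=\max_i L_{g_i}$. $J\mathcal{F}(x)$ is the $m\times n$ Jacobian matrix with rows $\nabla f_i(x)^\top$. $e_m=(1,\dots,1)^\top\in\mathbb{R}^m$,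 and $\preceq$ is the componentwise order on $\mathbb{R}^m$. The multiobjective problem is $\min \mathcal{V}(x)$ s.t. $x\in\Omega$. For $x,y\in\Omega$, $\psi(x,y)=\max_{i=1,\dots,m}\{\langle\nabla f_i(x),y-x\rangle+g_i(y)-g_i(x)\}$, $\theta(x)=\min_{y\in\Omega}\psi(x,y)$, and the merit function is $u_0(x)=\sup_{y\in\Omega}\min_{i=1,\dots,m}(\mathcal{V}_i(x)-\mathcal{V}_i(y))$. Algorithm 1. Fix real numbers $0<\sigma_{\min}\le 1$, $\alpha_{\min}>0$, $0<2\varepsilon_0<L$, $0<\beta<\frac12$, a point $x_0\in\Omega$, and real sequences $\{\sigma_k\},\{\alpha_k\}$ with $\sigma_{\min}\le\sigma_k\le 1$ and $\alpha_{\min}\le\alpha_k$ for all $k$ (the values $\sigma_k,\alpha_k$ may be chosen during the run, depending on $\theta(x_k)$). For $k=0,1,2,\dots$: Step 1: choose $y_k\in\Omega$ with $\psi(x_k,y_k)\le\max\{\sigma_k\theta(x_k),-\alpha_k\}$; if $\psi(x_k,y_k)=0$ stop. Step 2: let $d_k=y_k-x_k$ if $\psi(x_k,y_k)\le-\varepsilon_k\|y_k-x_k\|^2$, and otherwise $d_k=\frac{t_k(y_k-x_k)}{\varepsilon_k\|y_k-x_k\|^2}$, where $t_k=|\psi(x_k,y_k)|$. Step 3: let $l_k$ be the smallest positive integer $j$ such that $\mathcal{V}(x_k+(1-2\beta)^jd_k)-\mathcal{V}(x_k)\preceq(1-2\beta)^j\beta\big(J\mathcal{F}(x_k)d_k+\mathcal{G}(x_k+d_k)-\mathcal{G}(x_k)-\varepsilon_k\|d_k\|^2e_m\big)$,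 and set $\lambda_k=(1-2\beta)^{l_k}$. Step 4: set $x_{k+1}=x_k+\lambda_kd_k$ and $\varepsilon_{k+1}=\varepsilon_k(1-2\beta)^{1-l_k}$. Constants. $\gamma=\min\{\frac{2\varepsilon_0(1-2\beta)^2}{L},1-2\beta\}$; $\bar\varepsilon=\frac{L}{2(1-2\beta)}$; $\delta>0$ and $\rho_i>0$ are real numbers with $\|y_k-x_k\|\le\delta$ and $\|\nabla f_i(x_k)\|\le\rho_i$ for all $k$ and $i$ (they exist since $\Omega$ is compact); $\rho=\max_i\rho_i$; $\tau=\frac{\gamma}{\delta(\rho+L_G)}$; $\varpi=\min\{\tau,\frac{\gamma}{\bar\varepsilon\delta^2}\}$. *)

(* Defs.v *)
From HB Require Import structures.
From mathcomp Require Import all_boot all_order all_algebra.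
From mathcomp Require Import all_classical all_reals all_analysis.

Set Implicit Arguments.
Unset Strict Implicit.
Unset Printing Implicit Defensive.

Import Order.TTheory GRing.Theory Num.Theory.
Import numFieldNormedType.Exports.

Local Open Scope classical_set_scope.
Local Open Scope ring_scope.

(* Points of R^n are row vectors. The library norm `|_| on 'rV[R]_n is the
   sup norm; it is used only through its topology and the notion of derivative,
   which do not depend on the choice of norm. Every quantitative norm below is
   the Euclidean one. *)
Definition dot (R : realType) (n : nat) (u v : 'rV[R]_n) : R :=
  \sum_(j < n) u 0 j * v 0 j.

Definition enorm (R : realType) (n : nat) (u : 'rV[R]_n) : R :=
  Num.sqrt (dot u u).

Definition grad (R : realType) (n : nat) (h : 'rV[R]_n -> R) (x : 'rV[R]_n) :
    'rV[R]_n :=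
  \row_(j < n) 'D_(delta_mx 0 j) h x.

Definition continuously_differentiable (R : realType) (n : nat)
    (h : 'rV[R]_n -> R) : Prop :=
  (forall x, differentiable h x) /\ continuous (grad h).

Definition grad_lipschitz (R : realType) (n : nat) (h : 'rV[R]_n -> R)
    (c : R) : Prop :=
  forall x y, enorm (grad h x - grad h y) <= c * enorm (x - y).

Definition edom (R : realType) (n : nat) (h : 'rV[R]_n -> \bar R) :
    set 'rV[R]_n :=
  [set x | (h x < +oo)%E].

(* `eproper' includes the requirement that h takes values in R u {+oo}. *)
Definition eproper (R : realType) (n : nat) (h : 'rV[R]_n -> \bar R) : Prop :=
  (forall x, (-oo < h x)%E) /\ edom h !=set0.

(* The convention 0 * +oo = 0 makes the cases t = 0 and t = 1 trivial. *)
Definition econvex (R : realType) (n : nat) (h : 'rV[R]_n -> \bar R) : Prop :=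
  forall (x y : 'rV[R]_n) (t : R), 0 <= t <= 1 ->
    (h (t *: x + (1 - t) *: y)%R <= t%:E * h x + (1 - t)%:E * h y)%E.

Definition elipschitz_on_dom (R : realType) (n : nat) (h : 'rV[R]_n -> \bar R)
    (c : R) : Prop :=
  forall x y, edom h x -> edom h y ->
    (`|h x - h y| <= (c * enorm (x - y)%R)%:E)%E.

(* Maximum of a nonempty finite family. *)
Definition maxf (R : realType) (m : nat) (c : 'I_m.+1 -> R) : R :=
  \big[Num.max/c ord0]_(i < m.+1) c i.

Section Problem.
Context (R : realType) (m n : nat).
Variables (f : 'I_m -> 'rV[R]_n -> R) (g : 'I_m -> 'rV[R]_n -> \bar R).
Variable (Omega : set 'rV[R]_n).

Definition objective (i : 'I_m) (x : 'rV[R]_n) : \bar R :=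
  ((f i x)%:E + g i x)%E.

Definition JF (x : 'rV[R]_n) : 'M[R]_(m, n) := \matrix_(i < m) grad (f i) x.

Definition psi (x y : 'rV[R]_n) : \bar R :=
  \big[maxe/-oo%E]_(i < m)
    ((dot (grad (f i) x) (y - x))%:E + g i y - g i x)%E.

(* The infimum is a minimum when Omega is nonempty and compact, contained in
   every dom (g i), and every g i is lower semicontinuous. *)
Definition theta (x : 'rV[R]_n) : \bar R :=
  ereal_inf [set psi x y | y in Omega].

Definition merit (x : 'rV[R]_n) : \bar R :=
  ereal_sup [set \big[mine/+oo%E]_(i < m) (objective i x - objective i y)%E
            | y in Omega].

Definition direction (eps : R) (x y : 'rV[R]_n) : 'rV[R]_n :=
  if (psi x y <= (- (eps * enorm (y - x) ^+ 2))%:E)%E then y - x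
  else (fine `|psi x y|%E / (eps * enorm (y - x) ^+ 2)) *: (y - x).

Definition line_search (beta eps : R) (x d : 'rV[R]_n) (j : nat) : Prop :=
  forall i : 'I_m,
    (objective i (x + (1 - 2 * beta) ^+ j *: d)%R - objective i x <=
     ((1 - 2 * beta) ^+ j * beta)%:E *
       (((JF x *m d^T) i 0)%:E + g i (x + d)%R - g i x
        - (eps * enorm d ^+ 2)%:E))%E.

(* Infinite sequences of iterates. The stopping test psi (x k) (y k) = 0 is not
   part of the record: that it never succeeds is a separate assumption. *)
Record generated (sigma_min alpha_min beta : R) (sigma alpha : nat -> R)
    (x y d : nat -> 'rV[R]_n) (eps : nat -> R) (l : nat -> nat) : Prop :=
  Generated {
    gen_start : Omega (x 0%N);
    gen_sigma : forall k, sigma_min <= sigma k <= 1;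
    gen_alpha : forall k, alpha_min <= alpha k;
    gen_step1 : forall k, Omega (y k) /\
      (psi (x k) (y k) <=
         maxe ((sigma k)%:E * theta (x k)) (- alpha k)%:E)%E;
    gen_step2 : forall k, d k = direction (eps k) (x k) (y k);
    gen_step3 : forall k,
      [/\ (0 < l k)%N,
          line_search beta (eps k) (x k) (d k) (l k) &
          forall j, (0 < j < l k)%N ->
            ~ line_search beta (eps k) (x k) (d k) j];
    gen_step4_x : forall k, x k.+1 = x k + (1 - 2 * beta) ^+ l k *: d k;
    gen_step4_eps : forall k,
      eps k.+1 = eps k * (1 - 2 * beta) ^ (1 - (l k)%:Z)
  }.

End Problem.

(* Main.v *)
Require Import Defs.
From HB Require Import structures.
From mathcomp Require Import all_boot all_order all_algebra.
From mathcomp Require Import all_classical all_reals all_analysis.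
From mathcomp Require Import ring lra.

Set Implicit Arguments.
Unset Strict Implicit.
Unset Printing Implicit Defensive.

Import Order.TTheory GRing.Theory Num.Theory.
Import numFieldNormedType.Exports.

Local Open Scope classical_set_scope.
Local Open Scope ring_scope.

(** The sequence of merit values u_k = u_0(x_k) satisfies the strict recursion
    u_(k+1) < u_k - c u_k^2 with c = varpi beta sigma_min^2, and every
    nonnegative sequence with this property is below 1/(c k), because 1/u_k
    grows by more than c at each step ([quadratic_decrease_rate]).

    The recursion comes from comparing three quantities at x_k: the merit u_k,
    the number a_k = - theta(x_k), and t_k = - psi(x_k, y_k). Convexity of the
    f_i puts their linearizations below them, so u_k <= a_k
    ([merit_le_theta]); the acceptance test for y_k gives
    sigma_min a_k <= t_k ([residual_stationarity]). It remains to see that all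
    the objectives drop by more than varpi beta t_k^2 in one step: then so does
    each difference V_i(x_k) - V_i(y), and therefore u_k, since the drop does
    not depend on y.

    Write d_k = mu (y_k - x_k). Convexity of the g_i makes the model change
    along d_k at most - mu t_k, and the rule that fixes mu ensures
    eps_k |d_k|^2 <= mu t_k ([directionP], [line_search_start]). The accepted
    step thus lowers every objective by at least
    lambda_k beta (mu t_k + eps_k |d_k|^2), and the second term, positive, is
    what makes the recursion strict ([objval_decrease]).

    Two bounds turn lambda_k mu t_k into varpi t_k^2 ([residual_gain]). By the
    descent lemma for functions with a Lipschitz gradient the line search
    accepts every step s^j <= 2 s eps_k / L, with s = 1 - 2 beta
    ([line_search_short]); so a step is rejected only if it is longer than
    that, whence lambda_k >= gamma ([step_length_ge]) and eps_k < eps_bar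
    ([eps_lt]). And either mu = 1, where t_k <= delta (rho + L_G) by the
    Lipschitz bounds ([residual_le]), or mu eps_k |y_k - x_k|^2 = t_k, where
    t_k <= mu eps_bar delta^2. *)

(** * The Euclidean inner product *)

Section Euclidean.
Context (R : realType) (n : nat).
Implicit Types (u v w : 'rV[R]_n) (a : R).

Lemma dotC u v : dot u v = dot v u.
Proof. by apply: eq_bigr => j _; rewrite mulrC. Qed.

Lemma dotDl u v w : dot (u + v) w = dot u w + dot v w.
Proof. by rewrite -big_split; apply: eq_bigr => j _; rewrite mxE mulrDl. Qed.

Lemma dotZl a u v : dot (a *: u) v = a * dot u v.
Proof. by rewrite mulr_sumr; apply: eq_bigr => j _; rewrite mxE mulrA. Qed.

Lemma dotZr a u v : dot u (a *: v) = a * dot u v.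
Proof. by rewrite dotC dotZl dotC. Qed.

Lemma dotBl u v w : dot (u - v) w = dot u w - dot v w.
Proof. by rewrite -scaleN1r dotDl dotZl mulN1r. Qed.

Lemma dotBr u v w : dot u (v - w) = dot u v - dot u w.
Proof. by rewrite dotC dotBl !(dotC u). Qed.

Lemma dot_ge0 u : 0 <= dot u u.
Proof. by apply: sumr_ge0 => j _; rewrite -expr2 sqr_ge0. Qed.

Lemma enorm_ge0 u : 0 <= enorm u.
Proof. exact: sqrtr_ge0. Qed.

Lemma enorm_sqr u : enorm u ^+ 2 = dot u u.
Proof. by rewrite sqr_sqrtr ?dot_ge0. Qed.

Lemma enormZ a u : enorm (a *: u) = `|a| * enorm u.
Proof.
by rewrite /enorm dotZl dotZr mulrA -expr2 sqrtrM ?sqr_ge0// sqrtr_sqr.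
Qed.

Lemma enormN u : enorm (- u) = enorm u.
Proof. by rewrite -scaleN1r enormZ normrN1 mul1r. Qed.

Lemma enorm_gt0 u : u != 0 -> 0 < enorm u.
Proof.
apply: contra_neqT; rewrite -leNgt => un0.
have /eqP : dot u u = 0.
  have /eqP un : enorm u == 0 by rewrite eq_le un0 enorm_ge0.
  by rewrite -enorm_sqr un expr0n.
rewrite psumr_eq0 => [/allP u0|j _]; last by rewrite -expr2 sqr_ge0.
apply/rowP => j; rewrite mxE; apply/eqP; rewrite -sqrf_eq0 expr2.
by apply: (implyP (u0 j _)) => //; rewrite mem_index_enum.
Qed.

(** The discriminant argument, in the form that the squared length of
    |u|^2 v - (u.v) u is nonnegative. *)
Lemma cauchy_schwarz u v : dot u v <= enorm u * enorm v.
Proof.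
have [->|/enorm_gt0 u0] := eqVneq u 0.
  by rewrite -(scale0r v) dotZl mul0r mulr_ge0 ?enorm_ge0.
set a := enorm u in u0 *; set b := enorm v.
have uu : dot u u = a ^+ 2 by rewrite enorm_sqr.
have vv : dot v v = b ^+ 2 by rewrite enorm_sqr.
have := dot_ge0 (a ^+ 2 *: v - dot u v *: u).
rewrite !(dotBl, dotBr, dotZl, dotZr) (dotC v u) uu vv => h.
have h2 : 0 <= a ^+ 2 * ((a * b) ^+ 2 - dot u v ^+ 2).
  by apply: le_trans h _; rewrite le_eqVlt; apply/orP; left; apply/eqP; ring.
move: h2; rewrite pmulr_rge0 ?exprn_gt0// subr_ge0 => h2.
apply: le_trans (ler_norm _) _.
by rewrite -ler_sqr ?nnegrE ?mulr_ge0 ?enorm_ge0// real_normK ?num_real.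
Qed.

End Euclidean.

(** * First-order estimates along segments *)

(** Convexity as an inequality between real combinations: the library states it
    with weights in a bundled unit-interval type. *)
Lemma convex_functionE (R : realType) (n : nat) (h : 'rV[R]_n -> R)
    (x y : 'rV[R]_n) (t : R) :
  convex_function setT h -> 0 <= t <= 1 ->
  h (t *: x + (1 - t) *: y) <= t * h x + (1 - t) * h y.
Proof.
move=> h_cvx /andP[t0 t1].
have := h_cvx (Itv01 t0 t1) x y.
by rewrite !inE => /(_ I I).
Qed.

Lemma convex_setE (R : realType) (n : nat) (A : set 'rV[R]_n)
    (x y : 'rV[R]_n) (t : R) :
  convex_set A -> 0 <= t <= 1 -> A x -> A y -> A (t *: x + (1 - t) *: y).
Proof.
move=> A_cvx /andP[t0 t1] Ax Ay.
by have := A_cvx x y (Itv01 t0 t1); rewrite !inE; apply.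
Qed.

Section FirstOrder.
Context (R : realType) (n : nat).
Context (h : 'rV[R]_n.+1 -> R).
Implicit Types (x v : 'rV[R]_n.+1).

Lemma derive_dot_grad x v :
  differentiable h x -> 'D_v h x = dot (grad h x) v.
Proof.
move=> dh; rewrite deriveE// [in LHS](row_sum_delta v) linear_sum.
by apply: eq_bigr => j _; rewrite linearZ /= mxE deriveE// mulrC.
Qed.

Context (h_diff : forall x, differentiable h x).

Lemma is_derive_line x v (t : R) :
  is_derive t (1 : R) (fun s : R => h (x + s *: v))
    (dot (grad h (x + t *: v)) v).
Proof.
have quotientE : (fun s : R => s^-1 *:
    (((fun s : R => h (x + s *: v)) \o shift t) (s *: (1 : R))
      - h (x + t *: v))) =
  (fun s : R => s^-1 *: ((h \o shift (x + t *: v)) (s *: v) - h (x + t *: v))).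
  apply/funext => s /=; congr (_ *: (h _ - _)).
  by rewrite [s%:A]mulr1 scalerDl addrCA.
have dv : derivable h (x + t *: v) v by exact: diff_derivable.
apply: DeriveDef; first by rewrite /derivable quotientE.
by rewrite -derive_dot_grad// /derive quotientE.
Qed.

(** Descent lemma. The difference of the two sides, restricted to the segment
    t |-> x + t v, has derivative
    <grad h (x + t v) - grad h x, v> - c t |v|^2, which is nonpositive by
    Cauchy-Schwarz and the Lipschitz bound; the mean value theorem
    concludes. *)
Lemma grad_descent (c : R) x v : grad_lipschitz h c ->
  h (x + v) <= h x + dot (grad h x) v + c / 2 * enorm v ^+ 2.
Proof.
move=> h_lip.
pose phi (t : R) := h (x + t *: v) - (t * dot (grad h x) v
  + c / 2 * enorm v ^+ 2 * t ^+ 2).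
pose dphi (t : R) := dot (grad h (x + t *: v)) v
  - (dot (grad h x) v + c * enorm v ^+ 2 * t).
have phi_der t : is_derive t (1 : R) phi (dphi t).
  have D := is_derive_line x v t.
  apply: is_derive_eq; rewrite /dphi; congr (_ - _).
  by rewrite !scaler0 !add0r /GRing.scale /=; field.
have phi_cont : {within `[0, 1], continuous phi}.
  apply: derivable_within_continuous => t _.
  exact: (@ex_derive _ _ _ _ _ _ _ (phi_der t)).
have [xi t01] := MVT_segment ler01 (fun t _ => phi_der t) phi_cont.
rewrite subr0 mulr1 /phi scale1r scale0r addr0 => phi01.
have : dphi xi <= 0.
  rewrite /dphi opprD addrA -dotBl subr_le0.
  apply: le_trans (cauchy_schwarz _ _) _.
  move: t01; rewrite in_itv/= => /andP[xi0 _].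
  apply: le_trans (ler_wpM2r (enorm_ge0 _) (h_lip _ _)) _.
  rewrite addrAC subrr add0r enormZ (ger0_norm xi0) le_eqVlt.
  by apply/orP; left; apply/eqP; ring.
move: phi01; set A := h _; set B := h _; lra.
Qed.

(** The difference quotients (h (x + t (y - x)) - h x) / t are bounded by
    h y - h x for 0 < t <= 1; let t tend to 0 from the right. *)
Lemma convex_grad_le x y : convex_function setT h ->
  h x + dot (grad h x) (y - x) <= h y.
Proof.
move=> h_cvx; rewrite addrC -lerBrDr -derive_dot_grad//.
have dv : derivable h x (y - x) by exact: diff_derivable.
have /cvg_dnbhs_at_right quotient_lim :
  (fun t : R => t^-1 *: ((h \o shift x) (t *: (y - x)) - h x)) t
    @[t --> 0^'] --> 'D_(y - x) h x by exact: dv.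
apply: (cvgr_to_le quotient_lim); near=> t.
have t0 : 0 < t by near: t; exact: nbhs_right_gt.
have t1 : t <= 1 by near: t; exact: nbhs_right_le.
have := @convex_functionE _ _ h y x t h_cvx.
rewrite (ltW t0) t1 => /(_ isT).
have -> : t *: y + (1 - t) *: x = t *: (y - x) + x.
  by rewrite scalerBr scalerBl scale1r addrCA addrC -addrA addrC.
rewrite /GRing.scale /= => h_le.
rewrite mulrC ler_pdivrMr//.
by lra.
Unshelve. all: by end_near.
Qed.

End FirstOrder.

(** * The rate of a quadratically decreasing sequence *)

(** The invariant c k u_k < 1 is kept without dividing: if a and b are
    consecutive terms and c k a < 1, then
    c (k+1) b < c (k+1) (a - c a^2) = (1 - c a) (c k a + c a)
    < (1 - c a) (1 + c a) <= 1, where 1 - c a > 0 because b >= 0. *)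
Lemma quadratic_decrease_rate (R : realFieldType) (u : nat -> R) (c : R) :
    0 < c -> (forall k, 0 <= u k) ->
    (forall k, u k.+1 < u k - c * u k ^+ 2) ->
  forall k, (0 < k)%N -> u k < 1 / (c * k%:R).
Proof.
move=> c0 u0 u_dec.
have u_gt0 k : 0 < u k.
  apply: le_lt_trans (u0 k.+1) (lt_le_trans (u_dec k) _).
  by rewrite gerBl mulr_ge0 ?sqr_ge0// ltW.
have invariant k : c * k%:R * u k < 1.
  elim: k => [|k IH]; first by rewrite mulr0 mul0r.
  have := u_dec k; have := u0 k.+1; have := u_gt0 k; move: IH.
  set a := u k; set b := u k.+1 => IH a0 b0 ab.
  have ca1 : 0 < 1 - c * a by rewrite -(pmulr_rgt0 _ a0); nra.
  have k0 : 0 <= k%:R :> R by [].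
  have : c * k.+1%:R * b < c * k.+1%:R * (a - c * a ^+ 2).
    by rewrite ltr_pM2l// mulr_gt0// ltr0n.
  move/lt_le_trans; apply; rewrite -natr1.
  have -> : c * (k%:R + 1) * (a - c * a ^+ 2) =
    (1 - c * a) * (c * k%:R * a + c * a) by ring.
  apply: (@le_trans _ _ ((1 - c * a) * (1 + c * a))).
    by rewrite ler_pM2l// lerD2r ltW.
  by have := sqr_ge0 (c * a); lra.
move=> k k0; rewrite ltr_pdivlMr ?mulr_gt0 ?ltr0n//.
by rewrite mulrC.
Qed.

(** * Real-valued form of the problem on the feasible set *)

Lemma le_maxf (R : realType) (m : nat) (c : 'I_m.+1 -> R) i : c i <= maxf c.
Proof. exact: le_bigmax. Qed.

Lemma grad_lipschitz_le (R : realType) (n : nat) (h : 'rV[R]_n -> R)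
    (c c' : R) :
  c <= c' -> grad_lipschitz h c -> grad_lipschitz h c'.
Proof.
move=> cc' h_lip x y; apply: le_trans (h_lip x y) _.
by rewrite ler_wpM2r ?enorm_ge0.
Qed.

Lemma elipschitz_on_dom_le (R : realType) (n : nat) (h : 'rV[R]_n -> \bar R)
    (c c' : R) :
  c <= c' -> elipschitz_on_dom h c -> elipschitz_on_dom h c'.
Proof.
move=> cc' h_lip x y hx hy; apply: le_trans (h_lip x y hx hy) _.
by rewrite lee_fin ler_wpM2r ?enorm_ge0.
Qed.

Section RealValued.
Context (R : realType) (m n : nat).
Context (f : 'I_m.+1 -> 'rV[R]_n.+1 -> R).
Context (g : 'I_m.+1 -> 'rV[R]_n.+1 -> \bar R).
Context (Omega : set 'rV[R]_n.+1).
Context (g_proper : forall i, eproper (g i)).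
Context (Omega_dom : Omega `<=` \bigcap_i edom (g i)).
Implicit Types (x y d : 'rV[R]_n.+1) (i : 'I_m.+1).

(** The objectives are extended-real valued but finite on Omega, where every
    iterate and trial point lies; there the computations take place in R. *)
Definition gval i x : R := fine (g i x).

(** The term of index i in the maximum that defines psi. *)
Definition lin_change i x y : R :=
  dot (grad (f i) x) (y - x) + gval i y - gval i x.

Definition objval i x : R := f i x + gval i x.

Lemma gvalE i x : Omega x -> g i x = (gval i x)%:E.
Proof.
move=> Ox; rewrite fineK// fin_real//.
by rewrite (proj1 (g_proper i)) (Omega_dom Ox (i := i) I).
Qed.

Lemma objectiveE i x : Omega x -> objective f g i x = (objval i x)%:E.
Proof. by move=> Ox; rewrite /objective gvalE. Qed.

Lemma psi_termE i x y : Omega x -> Omega y ->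
  ((dot (grad (f i) x) (y - x))%:E + g i y - g i x)%E = (lin_change i x y)%:E.
Proof. by move=> Ox Oy; rewrite !gvalE. Qed.

Lemma psi_leP x y (r : R) : Omega x -> Omega y ->
  (psi f g x y <= r%:E)%E <-> forall i, lin_change i x y <= r.
Proof.
move=> Ox Oy; split=> [/bigmax_leP[_ change_le] i|change_le].
  by have := change_le i isT; rewrite psi_termE// lee_fin.
by apply/bigmax_leP; split=> [|i _]; rewrite ?leNye// psi_termE// lee_fin.
Qed.

Lemma psi_attained x y : Omega x -> Omega y ->
  exists i, psi f g x y = (lin_change i x y)%:E.
Proof.
move=> Ox Oy; exists [arg max_(i > ord0)
    ((dot (grad (f i) x) (y - x))%:E + g i y - g i x)%E]%O.
rewrite /psi (bigmax_eq_arg _ ord0)// ?psi_termE// => i _.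
by rewrite leNye.
Qed.

Lemma psi_fin x y : Omega x -> Omega y -> psi f g x y = (fine (psi f g x y))%:E.
Proof.
by move=> Ox Oy; have [i ->] := psi_attained Ox Oy.
Qed.

Lemma merit_leP x (r : R) : Omega x ->
  (merit f g Omega x <= r%:E)%E <->
  forall y, Omega y -> exists i, objval i x - objval i y <= r.
Proof.
move=> Ox; split=> [merit_le y Oy|ex_i].
  have := le_trans (ereal_sup_ubound (imageP _ Oy)) merit_le.
  rewrite (bigmin_eq_arg _ ord0)//; last by move=> i _; rewrite leey.
  by rewrite !objectiveE// lee_fin => ?; eexists; eassumption.
apply: ge_ereal_sup => _ [y Oy <-]; have [i ri] := ex_i y Oy.
by apply: (bigmin_inf i) => //; rewrite ?objectiveE ?lee_fin.
Qed.

(** The choice y = x makes every difference of objectives vanish. *)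
Lemma merit_ge0 x : Omega x -> (0 <= merit f g Omega x)%E.
Proof.
move=> Ox; apply: le_trans (ereal_sup_ubound (imageP _ Ox)).
apply/bigmin_geP; split=> [|i _]; rewrite ?leey// objectiveE//.
by rewrite -EFinB subrr.
Qed.

Context (g_convex : forall i, econvex (g i)) (Omega_convex : convex_set Omega).

Lemma segmentE x y (t : R) : x + t *: (y - x) = t *: y + (1 - t) *: x.
Proof. by rewrite scalerBr scalerBl scale1r addrCA. Qed.

Lemma Omega_segment x y (t : R) : 0 <= t <= 1 -> Omega x -> Omega y ->
  Omega (x + t *: (y - x)).
Proof. by move=> t01 Ox Oy; rewrite segmentE; exact: convex_setE. Qed.

Lemma gval_segment i x y (t : R) : 0 <= t <= 1 -> Omega x -> Omega y ->
  gval i (x + t *: (y - x)) <= gval i x + t * (gval i y - gval i x).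
Proof.
move=> t01 Ox Oy; have Oxy := Omega_segment t01 Ox Oy.
have := g_convex i y x t01; rewrite -segmentE !gvalE//.
by rewrite -!EFinM -EFinD lee_fin; lra.
Qed.

(** The linear part is homogeneous and g_i is convex, so the model change is
    sublinear along a segment that starts at the base point. *)
Lemma lin_change_segment i x y (t : R) : 0 <= t <= 1 -> Omega x -> Omega y ->
  lin_change i x (x + t *: (y - x)) <= t * lin_change i x y.
Proof.
move=> t01 Ox Oy; have := gval_segment i t01 Ox Oy.
by rewrite /lin_change (addrC x) addrK dotZr; lra.
Qed.

Lemma lin_changexx i x : lin_change i x x = 0.
Proof. by rewrite /lin_change subrr addrK -(scale0r x) dotZr mul0r. Qed.

Lemma line_searchP (beta eps : R) x d j :
    Omega x -> Omega (x + d) -> Omega (x + (1 - 2 * beta) ^+ j *: d) ->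
  line_search f g beta eps x d j <->
  forall i, objval i (x + (1 - 2 * beta) ^+ j *: d) - objval i x <=
    (1 - 2 * beta) ^+ j * beta * (lin_change i x (x + d) - eps * enorm d ^+ 2).
Proof.
move=> Ox Oxd Oxjd.
have JFE i : (JF f x *m d^T) i 0 = dot (grad (f i) x) d.
  by rewrite mxE; apply: eq_bigr => j' _; rewrite !mxE.
by split=> ls i; have := ls i;
  rewrite !objectiveE// !gvalE// JFE /lin_change (addrC x d) addrK -lee_fin.
Qed.

Context (f_diff : forall i z, differentiable (f i) z).

Lemma gval_lipschitz i (c : R) x y : elipschitz_on_dom (g i) c ->
  Omega x -> Omega y -> `|gval i x - gval i y| <= c * enorm (x - y).
Proof.
move=> g_lip Ox Oy.
have := g_lip x y (Omega_dom Ox (i := i) I) (Omega_dom Oy (i := i) I).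
by rewrite !gvalE// -EFinB abse_EFin lee_fin.
Qed.

Lemma lin_change_ge i (c : R) x y : elipschitz_on_dom (g i) c ->
  Omega x -> Omega y ->
  - lin_change i x y <= (enorm (grad (f i) x) + c) * enorm (y - x).
Proof.
move=> g_lip Ox Oy; rewrite -(enormN (y - x)) (opprB y x) mulrDl.
have := le_trans (ler_norm _) (gval_lipschitz g_lip Ox Oy).
have := cauchy_schwarz (grad (f i) x) (x - y).
have yx : y - x = (-1) *: (x - y) by rewrite scaleN1r opprB.
by rewrite /lin_change yx dotZr; lra.
Qed.

(** For each y some model change is at least theta x, and by convexity of f_i
    it underestimates the change of the objective. *)
Lemma merit_le_theta (a : R) x : (forall i, convex_function setT (f i)) ->
  Omega x -> theta f g Omega x = (- a)%:E -> (merit f g Omega x <= a%:E)%E.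
Proof.
move=> f_convex Ox thetaE; apply/merit_leP => // y Oy.
have : (theta f g Omega x <= psi f g x y)%E.
  by apply: ereal_inf_lbound; exact: imageP.
have [i ->] := psi_attained Ox Oy; rewrite thetaE lee_fin => a_le; exists i.
have := convex_grad_le (f_diff i) x y (f_convex i).
by move: a_le; rewrite /lin_change /objval; lra.
Qed.

(** * One iteration *)

(** Write s for the step, A_i for the model change along d and q for |d|^2. The
    descent lemma and convexity of g_i bound the change of the i-th objective
    by s A_i + L s^2 q / 2. Since A_i <= - eps q, the acceptance bound
    s beta (A_i - eps q) is at least this as soon as L s / 2 is at most
    ((1 - beta) - beta) eps. *)
Lemma line_search_short (beta eps L : R) x d j :
    0 < beta -> beta < 1 / 2 -> (forall i, grad_lipschitz (f i) L) ->
    Omega x -> Omega (x + d) ->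
    (forall i, lin_change i x (x + d) <= - (eps * enorm d ^+ 2)) ->
    (1 - 2 * beta) ^+ j * L <= 2 * (1 - 2 * beta) * eps ->
  line_search f g beta eps x d j.
Proof.
move=> beta0 beta1 f_lip Ox Oxd change_le short.
have s01 : 0 <= (1 - 2 * beta) ^+ j <= 1.
  by rewrite exprn_ge0 ?exprn_ile1//; lra.
have Oxjd : Omega (x + (1 - 2 * beta) ^+ j *: d).
  by have := Omega_segment s01 Ox Oxd; rewrite (addrC x d) addrK.
apply/line_searchP => // i.
have gle : gval i (x + (1 - 2 * beta) ^+ j *: d) <=
    gval i x + (1 - 2 * beta) ^+ j * (gval i (x + d) - gval i x).
  by have := gval_segment i s01 Ox Oxd; rewrite (addrC x d) addrK.
have fle := grad_descent (f_diff i) x ((1 - 2 * beta) ^+ j *: d) (f_lip i).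
have := change_le i; move: fle gle s01 short.
rewrite /objval /lin_change (addrC x d) addrK dotZr.
rewrite enormZ exprMn real_normK ?num_real//.
set s := _ ^+ j; set q := enorm d ^+ 2; set p := dot _ _.
set gd := gval i (d + x) - gval i x; rewrite -!addrA -/gd.
have q0 : 0 <= q by exact: sqr_ge0.
move=> fle gle /andP[s0 s1] short change_i.
(* The bounds on the step and on the model change, each multiplied by the
   nonnegative factor with which it enters; the rest is linear. *)
have curvature : s * (L / 2 * (s * q)) <= s * ((1 - 2 * beta) * eps * q).
  rewrite ler_wpM2l// mulrA ler_wpM2r//; lra.
have slope : s * ((1 - beta) * (p + gd)) <= s * ((1 - beta) * - (eps * q)).
  by rewrite !ler_wpM2l//; lra.
by rewrite /gd in slope gle; lra.
Qed.

(** The factor mu is 1 in the first case of the rule; in the second it is the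
    number below 1 for which the bound eps |d|^2 <= mu t is an equality. *)
Lemma directionP (eps t : R) x y : 0 < eps -> 0 < t ->
    psi f g x y = (- t)%:E -> x != y ->
  exists mu, [/\ 0 < mu <= 1, direction f g eps x y = mu *: (y - x),
    eps * enorm (mu *: (y - x)) ^+ 2 <= mu * t &
    mu = 1 \/ mu * (eps * enorm (y - x) ^+ 2) = t].
Proof.
move=> eps0 t0 psiE xy; rewrite /direction psiE lee_fin lerN2.
have q0 : 0 < eps * enorm (y - x) ^+ 2.
  by rewrite mulr_gt0// exprn_gt0// enorm_gt0// subr_eq0 eq_sym.
case: leP => [le_t|lt_t].
  by exists 1; rewrite scale1r mul1r ltr01 lexx; split=> //; left.
rewrite /= normrN gtr0_norm//; set mu := t / _.
have muE : mu * (eps * enorm (y - x) ^+ 2) = t by rewrite divfK// gt_eqF.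
have mu0 : 0 < mu by rewrite divr_gt0.
exists mu; split=> //; last by right.
  by rewrite mu0 ler_pdivrMr// mul1r ltW.
rewrite enormZ exprMn real_normK ?num_real// mulrCA expr2 -mulrA.
by rewrite muE.
Qed.

End RealValued.

(** * Sequences generated by the algorithm *)

Section Algorithm.
Context (R : realType) (m n : nat).
Context (f : 'I_m.+1 -> 'rV[R]_n.+1 -> R).
Context (g : 'I_m.+1 -> 'rV[R]_n.+1 -> \bar R).
Context (Omega : set 'rV[R]_n.+1) (L sigma_min alpha_min beta : R).
Context (sigma alpha : nat -> R) (x y d : nat -> 'rV[R]_n.+1).
Context (eps : nat -> R) (l : nat -> nat).
Context (Omega_convex : convex_set Omega)
  (Omega_dom : Omega `<=` \bigcap_i edom (g i))
  (g_convex : forall i, econvex (g i)) (g_proper : forall i, eproper (g i))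
  (f_diff : forall i z, differentiable (f i) z)
  (f_lip : forall i, grad_lipschitz (f i) L)
  (beta_gt0 : 0 < beta) (beta_lt : beta < 1 / 2)
  (eps0_gt0 : 0 < eps 0%N) (eps0_lt : 2 * eps 0%N < L)
  (sigma_min_gt0 : 0 < sigma_min).
Context (x_gen : generated f g Omega sigma_min alpha_min beta sigma alpha
               x y d eps l)
  (no_stop : forall k, psi f g (x k) (y k) <> 0%E)
  (max_sigma : forall k,
      (maxe ((sigma k)%:E * theta f g Omega (x k)) (- alpha k)%:E
       = (sigma k)%:E * theta f g Omega (x k))%E).

Local Notation shrink := (1 - 2 * beta).
Local Notation lin_change := (lin_change f g).
Local Notation objval := (objval f g).

Lemma shrink_gt0 : 0 < shrink.
Proof. by move: beta_lt; lra. Qed.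

Lemma shrink_lt1 : shrink < 1.
Proof. by move: beta_gt0; lra. Qed.

Local Hint Resolve shrink_gt0 : core.

Lemma L_gt0 : 0 < L.
Proof. by move: eps0_gt0 eps0_lt; lra. Qed.

Local Hint Resolve L_gt0 : core.

Lemma shrinkX_gt0 j : 0 < shrink ^+ j.
Proof. exact: exprn_gt0. Qed.

Lemma shrinkX_le1 j : shrink ^+ j <= 1.
Proof. by apply: exprn_ile1; apply: ltW; [|exact: shrink_lt1]. Qed.

Lemma epsS k p : l k = p.+1 -> eps k.+1 * shrink ^+ p = eps k.
Proof.
move=> lk; rewrite (gen_step4_eps x_gen) lk.
have -> : 1 - (p.+1)%:Z = - p%:Z.
  by rewrite -addn1 PoszD opprD addrCA subrr addr0.
by rewrite -exprnN mulfVK// gt_eqF ?shrinkX_gt0.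
Qed.

Lemma l_succ k : exists p, l k = p.+1.
Proof.
by have [l0 _ _] := gen_step3 x_gen k; exists (l k).-1; rewrite prednK.
Qed.

Lemma eps_gt0 k : 0 < eps k.
Proof.
elim: k => [//|k IH]; have [p lk] := l_succ k.
by rewrite -(pmulr_lgt0 _ (shrinkX_gt0 p)) (epsS lk).
Qed.

Lemma eps_ge k : eps 0%N <= eps k.
Proof.
elim: k => [//|k IH]; apply: le_trans IH _; have [p lk] := l_succ k.
rewrite -(epsS lk); apply: ler_piMr (shrinkX_le1 p).
exact: ltW (eps_gt0 _).
Qed.

Lemma theta_le z w : Omega w -> (theta f g Omega z <= psi f g z w)%E.
Proof. by move=> Ow; apply: ereal_inf_lbound; exact: imageP. Qed.

Lemma theta_le0 z : Omega z -> (theta f g Omega z <= 0)%E.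
Proof.
move=> Oz; apply: le_trans (theta_le z Oz) _.
by apply: (psi_leP f g_proper Omega_dom 0 Oz Oz).2 => i; rewrite lin_changexx.
Qed.

Lemma sigma_gt0 k : 0 < sigma k.
Proof. by case/andP: (gen_sigma x_gen k) => + _; exact: lt_le_trans. Qed.

(** The truncation level - alpha_k does not exceed sigma_k theta(x_k), which
    keeps theta(x_k) away from -oo. *)
Lemma theta_fin k : Omega (x k) ->
  theta f g Omega (x k) = (- - fine (theta f g Omega (x k)))%:E.
Proof.
move=> Ox; rewrite opprK fineK//.
have := theta_le0 Ox; have := max_sigma k.
case: (theta _ _ _ _) => [//| |] /=; first by rewrite leye_eq.
rewrite mulr_infty gtr0_sg ?sigma_gt0// mul1e => contra _.
have : ((- alpha k)%:E <= -oo)%E by rewrite -contra le_max lexx orbT.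
by rewrite leeNy_eq.
Qed.

(** The number t_k = |psi(x_k, y_k)| of the algorithm, as psi(x_k, y_k) < 0. *)
Definition residual k : R := - fine (psi f g (x k) (y k)).

Definition stationarity k : R := - fine (theta f g Omega (x k)).

Lemma residualP k : Omega (x k) ->
  psi f g (x k) (y k) = (- residual k)%:E /\ 0 < residual k.
Proof.
move=> Ox; have [Oy psi_le] := gen_step1 x_gen k.
have psiE : psi f g (x k) (y k) = (- residual k)%:E.
  by rewrite opprK -(psi_fin f g_proper Omega_dom).
split=> //; have := no_stop (k := k); rewrite psiE => psi0.
have : ((- residual k)%:E <= 0)%E.
  rewrite -psiE; apply: le_trans psi_le _; rewrite max_sigma.
  by rewrite mule_ge0_le0 ?theta_le0// lee_fin ltW// sigma_gt0.
rewrite lee_fin oppr_le0 le_eqVlt => /predU1P[r0|//].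
by case: psi0; rewrite -r0 oppr0.
Qed.

(** The test for y_k asks for a fraction sigma_k of the best possible model decrease. *)
Lemma residual_stationarity k : Omega (x k) ->
  0 <= stationarity k /\ sigma_min * stationarity k <= residual k.
Proof.
move=> Ox; have [psiE _] := residualP Ox; have thetaE := theta_fin Ox.
have a0 : 0 <= stationarity k.
  by have := theta_le0 Ox; rewrite thetaE lee_fin oppr_le0.
split=> //; have [_] := gen_step1 x_gen k.
rewrite max_sigma psiE thetaE -EFinM lee_fin mulrN lerN2; apply: le_trans.
by case/andP: (gen_sigma x_gen k) => sk _; rewrite ler_wpM2r.
Qed.

Lemma lin_change_residual k i : Omega (x k) ->
  lin_change i (x k) (y k) <= - residual k.
Proof.
move=> Ox; have [psiE _] := residualP Ox.
have [Oy _] := gen_step1 x_gen k.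
by apply: (psi_leP f g_proper Omega_dom _ Ox Oy).1 i; rewrite psiE.
Qed.

Lemma x_neq_y k : Omega (x k) -> x k != y k.
Proof.
move=> Ox; have [_ r0] := residualP Ox; apply/eqP => xy.
by have := lin_change_residual ord0 Ox; rewrite -xy lin_changexx; lra.
Qed.

Lemma stepP k : Omega (x k) -> exists mu, [/\ 0 < mu <= 1,
    d k = mu *: (y k - x k),
    eps k * enorm (d k) ^+ 2 <= mu * residual k &
    mu = 1 \/ mu * (eps k * enorm (y k - x k) ^+ 2) = residual k].
Proof.
move=> Ox; have [psiE r0] := residualP Ox.
have [mu [mu01 dE dle mu_case]] := directionP (eps_gt0 k) r0 psiE (x_neq_y Ox).
by exists mu; rewrite (gen_step2 x_gen) dE.
Qed.

(** Both the direction factor and the step length lie in [0, 1], so each iterate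
    stays on the segment from its predecessor to the trial point y_k. *)
Lemma Omega_x k : Omega (x k).
Proof.
elim: k => [|k Ox]; first exact: (gen_start x_gen).
have [mu [/andP[mu0 mu1] dE _ _]] := stepP Ox.
have [Oy _] := gen_step1 x_gen k.
rewrite (gen_step4_x x_gen) dE scalerA; apply: Omega_segment => //.
have sj0 := ltW (shrinkX_gt0 (l k)); rewrite mulr_ge0 ?(ltW mu0)//=.
exact: mulr_ile1 sj0 (ltW mu0) (shrinkX_le1 _) mu1.
Qed.

Lemma Omega_xd k : Omega (x k + d k).
Proof.
have Ox := Omega_x k; have [mu [/andP[mu0 mu1] -> _ _]] := stepP Ox.
have [Oy _] := gen_step1 x_gen k.
by apply: Omega_segment => //; rewrite ltW.
Qed.

Lemma line_search_start k : exists mu, [/\ 0 < mu,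
    mu = 1 \/ mu * (eps k * enorm (y k - x k) ^+ 2) = residual k,
    eps k * enorm (d k) ^+ 2 <= mu * residual k, 0 < enorm (d k) &
    forall i, lin_change i (x k) (x k + d k) <= - (mu * residual k)].
Proof.
have Ox := Omega_x k; have [mu [/andP[mu0 mu1] dE dle mu_case]] := stepP Ox.
have [Oy _] := gen_step1 x_gen k.
exists mu; split=> //.
  by rewrite dE enorm_gt0// scaler_eq0 subr_eq0 negb_or gt_eqF// eq_sym x_neq_y.
move=> i; rewrite dE; apply: le_trans.
  by apply: (lin_change_segment f g_proper Omega_dom) => //; rewrite ltW.
by rewrite -mulrN ler_wpM2l ?lin_change_residual// ltW.
Qed.

(** The last step tried before the accepted one was rejected, so it must be
    longer than those that the line search is sure to accept. *)
Lemma rejected_step k p : l k = p.+2 ->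
  2 * shrink * eps k < shrink ^+ p.+1 * L.
Proof.
move=> lk; rewrite ltNge; apply/negP => short.
have [_ _ /(_ p.+1)] := gen_step3 x_gen k; rewrite lk ltnSn => /(_ isT); apply.
have [mu [_ _ dle _ change_le]] := line_search_start k.
apply: (line_search_short g_proper Omega_dom g_convex Omega_convex f_diff
  beta_gt0 beta_lt f_lip (Omega_x k) (Omega_xd k) _ short) => i.
by apply: le_trans (change_le i) _; rewrite lerN2.
Qed.

(** Initially eps_0 < L / 2. When eps grows, it is divided by the last rejected
    step, which is longer than 2 s eps / L with s = 1 - 2 beta; otherwise it
    stays the same. *)
Lemma eps_lt k : eps k < L / (2 * shrink).
Proof.
have s1 := shrink_lt1; have s0 := shrink_gt0.
have s20 : 0 < 2 * shrink by rewrite mulr_gt0.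
elim: k => [|k IH].
  rewrite ltr_pdivlMr//.
  by apply: le_lt_trans eps0_lt; rewrite mulrCA ler_pM2l// ger_pMr// ltW.
have [[|p] lk] := l_succ k; first by have := epsS lk; rewrite mulr1 => ->.
have := rejected_step lk; rewrite -(epsS lk) ltr_pdivlMr//.
by rewrite mulrA [X in _ < X]mulrC ltr_pM2r ?shrinkX_gt0// mulrC.
Qed.

(** A step other than the first trial one is s = 1 - 2 beta times a rejected
    step, and eps never goes below its initial value. *)
Lemma step_length_ge k :
  Num.min (2 * eps 0%N * shrink ^+ 2 / L) shrink <= shrink ^+ l k.
Proof.
have [[|p] lk] := l_succ k; rewrite lk ge_min; first by rewrite lexx orbT.
apply/orP; left; rewrite ler_pdivrMr// [_ ^+ p.+2]exprS.
have := rejected_step lk; have := eps_ge k => epsk short.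
apply: (@le_trans _ _ (shrink * (2 * shrink * eps k))).
  have -> : 2 * eps 0%N * shrink ^+ 2 = shrink * (2 * shrink * eps 0%N) by ring.
  by rewrite ler_pM2l// ler_pM2l// mulr_gt0.
by rewrite -[leRHS]mulrA ler_pM2l// ltW.
Qed.

(** The slack is the part of the decrease due to the regularization term; it is
    positive and common to all objectives, so strictness survives the supremum
    that defines the merit function. *)
Lemma objval_decrease k : exists mu, [/\ 0 < mu,
    mu = 1 \/ mu * (eps k * enorm (y k - x k) ^+ 2) = residual k &
    exists2 slack, 0 < slack & forall i, objval i (x k.+1) <=
      objval i (x k) - shrink ^+ l k * beta * (mu * residual k) - slack].
Proof.
have [mu [mu0 mu_case dle d0 change_le]] := line_search_start k.
exists mu; split=> //.
exists (shrink ^+ l k * beta * (eps k * enorm (d k) ^+ 2)).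
  by rewrite !mulr_gt0 ?shrinkX_gt0 ?exprn_gt0 ?eps_gt0.
move=> i; have [_ ls _] := gen_step3 x_gen k.
have Ox1 := Omega_x k.+1; rewrite (gen_step4_x x_gen) in Ox1 *.
have := (line_searchP f g_proper Omega_dom _ (Omega_x k) (Omega_xd k) Ox1).1
  ls i.
have : shrink ^+ l k * beta * lin_change i (x k) (x k + d k) <=
  shrink ^+ l k * beta * - (mu * residual k).
  by rewrite ler_wpM2l// mulr_ge0// ltW// shrinkX_gt0.
by lra.
Qed.

(** * Decrease of the merit function *)

Context (f_convex : forall i, convex_function setT (f i)) (LG rho delta : R)
  (g_lip : forall i, elipschitz_on_dom (g i) LG)
  (rho_gt0 : 0 < rho) (delta_gt0 : 0 < delta)
  (delta_bound : forall k, enorm (y k - x k) <= delta)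
  (rho_bound : forall k i, enorm (grad (f i) (x k)) <= rho).

Local Notation gamma :=
  (Num.min (2 * eps 0%N * shrink ^+ 2 / L) shrink).
Local Notation tau := (gamma / (delta * (rho + LG))).
Local Notation eps_bar := (L / (2 * shrink)).
Local Notation varpi := (Num.min tau (gamma / (eps_bar * delta ^+ 2))).

(** A Lipschitz constant can be negative only on a one-point domain; here x_0
    and y_0 are two points. *)
Lemma LG_ge0 : 0 <= LG.
Proof.
have Ox := Omega_x 0; have [Oy _] := gen_step1 x_gen 0%N.
have xy : 0 < enorm (x 0%N - y 0%N).
  by rewrite enorm_gt0// subr_eq0 x_neq_y.
rewrite -(pmulr_lge0 _ xy).
have := gval_lipschitz g_proper Omega_dom (@g_lip ord0) Ox Oy.
by apply: le_trans; exact: normr_ge0.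
Qed.

Lemma slope_bound_gt0 : 0 < delta * (rho + LG).
Proof. by rewrite mulr_gt0// ltr_wpDr// LG_ge0. Qed.

Lemma gamma_gt0 : 0 < gamma.
Proof.
have e0 : 0 < 2 * eps 0%N by rewrite mulr_gt0.
rewrite lt_min shrink_gt0 andbT divr_gt0//.
by rewrite mulr_gt0// shrinkX_gt0.
Qed.

Lemma curvature_bound_gt0 : 0 < eps_bar * delta ^+ 2.
Proof.
have s20 : 0 < 2 * shrink by rewrite mulr_gt0.
by rewrite mulr_gt0 ?exprn_gt0// divr_gt0.
Qed.

Lemma varpi_gt0 : 0 < varpi.
Proof.
have g0 := gamma_gt0; rewrite lt_min.
by rewrite (divr_gt0 g0 slope_bound_gt0) (divr_gt0 g0 curvature_bound_gt0).
Qed.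

Lemma residual_le k : residual k <= delta * (rho + LG).
Proof.
have Ox := Omega_x k; have [Oy _] := gen_step1 x_gen k.
have r_le : residual k <= - lin_change ord0 (x k) (y k).
  by rewrite lerNr lin_change_residual.
apply: le_trans r_le _.
apply: (le_trans (lin_change_ge f g_proper Omega_dom _ Ox Oy)).
  exact: g_lip.
rewrite mulrC; apply: ler_pM; rewrite ?lerD2r ?enorm_ge0//.
by rewrite addr_ge0 ?enorm_ge0 ?LG_ge0.
Qed.

(** The two arguments of the minimum defining varpi serve the two cases for
    mu. *)
Lemma residual_gain k mu : 0 < mu ->
    mu = 1 \/ mu * (eps k * enorm (y k - x k) ^+ 2) = residual k ->
  varpi * residual k ^+ 2 <= shrink ^+ l k * (mu * residual k).
Proof.
move=> mu0 mu_case; have [_ r0] := residualP (Omega_x k).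
have gamma0 := gamma_gt0.
apply: (@le_trans _ _ (gamma * (mu * residual k))); last first.
  by rewrite ler_wpM2r ?step_length_ge// ltW// mulr_gt0.
rewrite [residual k ^+ 2]expr2 [leLHS]mulrA [leRHS]mulrA ler_pM2r//.
case: mu_case => [->|muE].
  rewrite mulr1; apply: (@le_trans _ _ (tau * residual k)).
    by rewrite ler_pM2r// ge_min lexx.
  rewrite mulrAC ler_pdivrMr ?slope_bound_gt0// ler_pM2l//.
  exact: residual_le.
apply: (@le_trans _ _ (gamma / (eps_bar * delta ^+ 2) * residual k)).
  by rewrite ler_pM2r// ge_min lexx orbT.
rewrite mulrAC ler_pdivrMr ?curvature_bound_gt0// -[leRHS]mulrA ler_pM2l//.
rewrite -muE ler_pM2l//; apply: ler_pM; rewrite ?exprn_ge0 ?enorm_ge0//.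
- exact: ltW (eps_gt0 k).
- exact: ltW (eps_lt k).
- by rewrite ler_sqr ?nnegrE ?enorm_ge0// ltW.
Qed.

Local Notation u k := (fine (merit f g Omega (x k))).

Lemma merit_stationarity k :
  [/\ merit f g Omega (x k) = (u k)%:E, 0 <= u k & u k <= stationarity k].
Proof.
have Ox := Omega_x k; have thetaE := theta_fin Ox.
have le0 := merit_ge0 f g_proper Omega_dom Ox.
have lea := merit_le_theta g_proper Omega_dom f_diff f_convex Ox thetaE.
have uE : merit f g Omega (x k) = (u k)%:E.
  by rewrite fineK// ge0_fin_numE//; apply: le_lt_trans lea (ltry _).
by split=> //; rewrite -lee_fin -uE.
Qed.

Lemma merit_decrease k :
  u k.+1 < u k - varpi * beta * sigma_min ^+ 2 * u k ^+ 2.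
Proof.
have [uE u0 ua] := merit_stationarity k.
have [uSE _ _] := merit_stationarity k.+1.
have Ox := Omega_x k; have OxS := Omega_x k.+1.
have [a0 ar] := residual_stationarity Ox.
have [mu [mu0 mu_case [slack slack0 decr]]] := objval_decrease k.
have gain := residual_gain mu0 mu_case.
have u_gain : varpi * beta * sigma_min ^+ 2 * u k ^+ 2 <=
    shrink ^+ l k * beta * (mu * residual k).
  have su : (sigma_min * u k) ^+ 2 <= residual k ^+ 2.
    have su0 : 0 <= sigma_min * u k by rewrite mulr_ge0// ltW.
    have sur : sigma_min * u k <= residual k.
      by apply: le_trans ar; rewrite ler_pM2l.
    by rewrite ler_sqr// nnegrE//; apply: le_trans sur.
  have -> : varpi * beta * sigma_min ^+ 2 * u k ^+ 2 =
    beta * (varpi * (sigma_min * u k) ^+ 2) by ring.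
  rewrite [shrink ^+ _ * beta]mulrC -[leRHS]mulrA ler_pM2l//.
  by apply: le_trans gain; rewrite ler_pM2l// varpi_gt0.
apply: (@le_lt_trans _ _
  (u k - varpi * beta * sigma_min ^+ 2 * u k ^+ 2 - slack));
  last by rewrite gtrBl.
rewrite -lee_fin -uSE.
apply: (merit_leP f g_proper Omega_dom _ OxS).2 => z Oz.
have [|i Viz] := (merit_leP f g_proper Omega_dom (u k) Ox).1 _ z Oz.
  by rewrite uE.
by exists i; have := decr i; lra.
Qed.

Lemma merit_rate k : (0 < k)%N ->
  (merit f g Omega (x k) <
    (1 / (varpi * beta * sigma_min ^+ 2 * k%:R))%:E)%E.
Proof.
move=> k0; have [-> _ _] := merit_stationarity k; rewrite lte_fin.
apply: (quadratic_decrease_rate (u := fun k => u k)) => //.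
- by rewrite !mulr_gt0 ?exprn_gt0 ?varpi_gt0.
- by move=> j; have [] := merit_stationarity j.
- exact: merit_decrease.
Qed.

End Algorithm.

Theorem theorem3 (R : realType) (m n : nat)
    (f : 'I_m.+1 -> 'rV[R]_n.+1 -> R) (g : 'I_m.+1 -> 'rV[R]_n.+1 -> \bar R)
    (Omega : set 'rV[R]_n.+1) (Lf Lg : 'I_m.+1 -> R)
    (sigma_min alpha_min beta : R) (sigma alpha : nat -> R)
    (x y d : nat -> 'rV[R]_n.+1) (eps : nat -> R) (l : nat -> nat)
    (delta : R) (rho : 'I_m.+1 -> R)
    (Omega_neq0 : Omega !=set0) (Omega_compact : compact Omega)
    (Omega_convex : convex_set Omega)
    (f_convex : forall i, convex_function setT (f i))
    (f_C1 : forall i, continuously_differentiable (f i))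
    (f_lip : forall i, grad_lipschitz (f i) (Lf i))
    (g_convex : forall i, econvex (g i))
    (g_proper : forall i, eproper (g i))
    (g_lsc : forall i, lower_semicontinuous (g i))
    (g_lip : forall i, elipschitz_on_dom (g i) (Lg i))
    (Omega_dom : Omega `<=` \bigcap_i edom (g i))
    (sigma_min_gt0 : 0 < sigma_min) (sigma_min_le1 : sigma_min <= 1)
    (alpha_min_gt0 : 0 < alpha_min)
    (eps0_gt0 : 0 < 2 * eps 0%N)
    (eps0_lt : 2 * eps 0%N < maxf Lf)
    (beta_gt0 : 0 < beta) (beta_lt : beta < 1 / 2)
    (x_gen : generated f g Omega sigma_min alpha_min beta sigma alpha
               x y d eps l)
    (no_stop : forall k, psi f g (x k) (y k) <> 0%E)
    (max_sigma : forall k,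
      (maxe ((sigma k)%:E * theta f g Omega (x k)) (- alpha k)%:E
       = (sigma k)%:E * theta f g Omega (x k))%E)
    (delta_gt0 : 0 < delta) (rho_gt0 : forall i, 0 < rho i)
    (delta_bound : forall k, enorm (y k - x k) <= delta)
    (rho_bound : forall k i, enorm (grad (f i) (x k)) <= rho i)
    (lower_bound : exists2 xstar, Omega xstar &
      forall k i, (objective f g i xstar <= objective f g i (x k))%E) :
  let L := maxf Lf in
  let LG := maxf Lg in
  let gamma := Num.min (2 * eps 0%N * (1 - 2 * beta) ^+ 2 / L)
                       (1 - 2 * beta) in
  let eps_bar := L / (2 * (1 - 2 * beta)) in
  let tau := gamma / (delta * (maxf rho + LG)) in
  let varpi := Num.min tau (gamma / (eps_bar * delta ^+ 2)) in
  forall k : nat, (1 <= k)%N ->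
    (merit f g Omega (x k) <
      (1 / (varpi * beta * sigma_min ^+ 2 * k%:R))%:E)%E.
Proof.
move=> L LG gamma eps_bar tau varpi k k0.
have rho_le j i : enorm (grad (f i) (x j)) <= maxf rho.
  exact: le_trans (rho_bound j i) (le_maxf rho i).
have e0 : 0 < eps 0%N by rewrite -(pmulr_rgt0 _ (ltr0n R 2)).
apply: (merit_rate Omega_convex Omega_dom g_convex g_proper
  (fun i => (f_C1 i).1) _ beta_gt0 beta_lt e0 eps0_lt sigma_min_gt0 x_gen
  no_stop max_sigma f_convex _ _ delta_gt0 delta_bound rho_le k0).
- by move=> i; exact: grad_lipschitz_le (le_maxf Lf i) (f_lip i).
- by move=> i; exact: elipschitz_on_dom_le (le_maxf Lg i) (g_lip i).
- exact: lt_le_trans (rho_gt0 ord0) (le_maxf rho ord0).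
Qed.
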